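(* For any fixed natural $d$ there exists $\varepsilon > 0$ and there exists $n_0 \in \mathbb{N}$ such that for every distance graph $G$ in $\mathbb{R}^d$ with $n \ge n_0$ vertices, $$cl\left(G, \left[\tfrac{d}{2}\right]+1\right) \le n^{\left[\frac{d}{2}\right]+1-\varepsilon}.$$
   Context: $[x]$ denotes the integer part of $x$. A graph $G$ is a (unit) distance graph in $d$-dimensional Euclidean space $\mathbb{R}^d$ if $V(G) \subseteq \mathbb{R}^d$ and $E(G) \subseteq \{(x,y) \in V(G)^2 : |x-y|=1\}$ (not all pairs at unit distance need be edges). For a graph $G$, $Cl(G,r)$ denotes the set of $r$-cliques (complete subgraphs on $r$ vertices) in $G$, and $cl(G,r)=|Cl(G,r)|$ is their number.
   Formalization: The case d = 1 is excluded, because the claim is false there: [1/2]+1 = 1, so cl(G,1) = n, and n ≤ n^(1−ε) fails for every n ≥ 2 and every ε > 0. *)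

(* Defs.v *)
From HB Require Import structures.
From mathcomp Require Import all_boot all_order all_algebra.
From mathcomp Require Import finmap.
From mathcomp Require Import reals exp.

Set Implicit Arguments.
Unset Strict Implicit.
Unset Printing Implicit Defensive.

Import Order.TTheory GRing.Theory Num.Theory.
Local Open Scope ring_scope.

(* Finite simple graphs whose vertices are points of [T]; the edges are
   unordered, so adjacency is a symmetric relation. *)
Record graph (T : choiceType) := Graph {
  vertices : {fset T};
  adj : rel vertices;
  adj_sym : symmetric adj;
  adj_irrefl : irreflexive adj
}.

Definition nvertices (T : choiceType) (G : graph T) : nat := #|` vertices G |.

(* The library norm on ['rV[R]_d] is the sup norm, hence this definition. *)
Definition euclidean_dist (R : realType) (d : nat) (x y : 'rV[R]_d) : R :=
  Num.sqrt (\sum_(i < d) (x 0 i - y 0 i) ^+ 2).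

(* Only one implication: pairs at unit distance need not be adjacent. *)
Definition distance_graph (R : realType) (d : nat) (G : graph 'rV[R]_d) : Prop :=
  forall x y : vertices G, adj x y -> euclidean_dist (val x) (val y) = 1.

(* A complete subgraph is identified with its vertex set. *)
Definition Cl (T : choiceType) (G : graph T) (r : nat) :
    {set {set vertices G}} :=
  [set K : {set vertices G} |
     (#|K| == r) && [forall x in K, forall y in K, (x != y) ==> adj x y]].

Definition cl (T : choiceType) (G : graph T) (r : nat) : nat := #|Cl G r|.

(* Main.v *)
Require Import Defs.
From mathcomp Require Import all_boot all_order all_algebra.
From mathcomp Require Import finmap lra zify.
From mathcomp Require Import reals exp.

(** Put r = [d/2] + 1. The r-cliques of a graph form an r-uniform hypergraph on
    its vertices, and Erdos showed that such a hypergraph, once it has more than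
    n ^ (r - eps) edges, contains a complete r-partite one with all parts of
    size 3. A distance graph in dimension d contains no such configuration:
    if all distances between two parts are 1, then the differences within one
    part are orthogonal to the differences within the other, and the three
    points of a part lie on a unit sphere centred at a point of another part,
    hence are not collinear. The r parts would therefore span r pairwise
    orthogonal planes, which needs 2r <= d, whereas 2r > d
    ([no_unit_multipartite]).

    The extremal theorem ([erdos_box]) is proved by induction on r. View a set E
    of r+1-tuples as the family of its links, one for each first entry. By
    convexity, for E of density p, the common intersection of t links has
    average density at least p ^ t over all families of t vertices; only a
    proportion O(1/n) of those families have a repeated vertex, so some t
    distinct vertices have a common link of density at least p ^ t / 2
    ([injective_common_large]). A box in that common link, together with these t
    vertices, is a box in E. Iterating, E contains a box as soon as
    p ^ (t ^ r) * n exceeds a constant C. With t = 3 and N = 3 ^ r, a graph without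
    a box thus has clique density p with p ^ N * n <= C. The constant is
    absorbed by halving the exponent: squaring gives p ^ (2N) * n <= 1 once
    n >= C ^ 2, which is the claim with eps = 1 / (2N).

    For d = 0 there is at most one vertex, and the claim holds vacuously with
    n0 = 2. *)

Set Implicit Arguments.
Unset Strict Implicit.
Unset Printing Implicit Defensive.

Import Order.TTheory GRing.Theory Num.Theory.
Local Open Scope ring_scope.

(** * Dense families of sets have large common intersections *)

(** The graph of the convex function a ^ (t + 1) lies above its tangent at m. *)
Lemma tangent_exprn (R : realFieldType) (t : nat) (a m : R) :
  0 <= a -> 0 <= m ->
  t.+1%:R * m ^+ t * a <= a ^+ t.+1 + t%:R * m ^+ t.+1.
Proof.
move=> a0 m0; elim: t => [|t IHt]; first by rewrite expr0 expr1 !mul1r mul0r addr0.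
have := ler_wpM2l a0 IHt.
(* The inductive step loses exactly this multiple of a square. *)
have : 0 <= t.+1%:R * m ^+ t * (a - m) ^+ 2.
  by rewrite mulr_ge0 ?sqr_ge0 // mulr_ge0 // exprn_ge0.
rewrite !exprS -(natr1 t.+1) -!(natr1 t).
set x := m ^+ t; set y := a ^+ t; set k : R := t%:R.
nra.
Qed.

(** Summing the tangent inequality at the mean m of the values of a makes the
    deviations from m cancel. *)
Lemma power_mean_exprn (R : realFieldType) (W : finType) (t : nat) (a : W -> R) :
  (forall w, 0 <= a w) ->
  (\sum_w a w) ^+ t.+1 <= #|W|%:R ^+ t * \sum_w a w ^+ t.+1.
Proof.
move=> a0; set S := \sum_w a w.
have S0 : 0 <= S by apply: sumr_ge0 => w _.
have [W0 | Wpos] := posnP #|W|.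
  rewrite /S !big1 ?exprS ?mul0r ?mulr0 // => w _;
  by have := fintype0 w W0.
set c : R := #|W|%:R; have c0 : 0 < c by rewrite ltr0n.
set m := S / c; have m0 : 0 <= m by rewrite divr_ge0 // ltW.
have Sm : S = m * c by rewrite divfK // gt_eqF.
have : \sum_w (t.+1%:R * m ^+ t * a w) <=
       \sum_w (a w ^+ t.+1 + t%:R * m ^+ t.+1).
  by apply: ler_sum => w _; apply: tangent_exprn.
rewrite -mulr_sumr -/S big_split /= sumr_const -[X in _ + X]mulr_natl -/c Sm.
move=> le_sum.
have : m ^+ t.+1 * c <= \sum_w a w ^+ t.+1.
  by move: le_sum; rewrite -natr1 exprS; lra.
move/(ler_wpM2l (exprn_ge0 t (ltW c0))); apply: le_trans.
by rewrite exprMn [c ^+ t.+1]exprSr mulrCA !mulrA.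
Qed.

(** Both sides count the pairs of a map f and a point w that lies in all the
    sets L (f i): given w, the values of f are chosen independently. *)
Lemma sum_card_common (V W : finType) (t : nat) (L : V -> {set W}) :
  (\sum_(f : {ffun 'I_t -> V}) #|\bigcap_i L (f i)|
   = \sum_w (\sum_y (w \in L y)) ^ t)%N.
Proof.
transitivity (\sum_(f : {ffun 'I_t -> V}) \sum_w (w \in \bigcap_i L (f i)))%N.
  by apply: eq_bigr => f _; rewrite -sum1_card big_mkcond.
rewrite exchange_big /=; apply: eq_bigr => w _.
have -> : ((\sum_y (w \in L y)) ^ t
          = \prod_(i < t) \sum_y (w \in L y))%N by rewrite prod_nat_const card_ord.
rewrite bigA_distr_bigA /=; apply: eq_bigr => f _.
have [/bigcapP wL | wL] := boolP (w \in _).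
  by rewrite big1 // => i _; rewrite wL.
have [i wi] : exists i, w \notin L (f i).
  apply/existsP; apply: contraR wL; rewrite negb_exists => /forallP wL.
  by apply/bigcapP => i _; have := wL i; rewrite negbK.
by rewrite (bigD1 i) //= (negbTE wi).
Qed.

(** Repetitions are rare among sequences of a fixed length: this bounds by
    O(n ^ t) the number of non-injective ones of length t + 1. *)
Lemma expn_le_ffact (n t : nat) :
  (n ^ t.+1 <= n ^_ t.+1 + t * t.+1 * n ^ t)%N.
Proof.
elim: t => [|t IHt]; first by rewrite ffactn1 expn1 leq_addr.
have le_ffact : (n ^_ t.+1 <= n ^ t.+1)%N.
  by elim: t.+1 => // k IHk; rewrite ffactnSr expnSr leq_mul ?leq_subr.
rewrite ffactnSr [in leqLHS]expnS.
have : (n ^_ t.+1 * n <= n ^_ t.+1 * (n - t.+1) + n ^_ t.+1 * t.+1)%N.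
  by rewrite -mulnDr leq_mul2l addnC -leq_subLR leqnn orbT.
move: IHt le_ffact; rewrite (expnS n t); nia.
Qed.

Lemma card_not_injective (V : finType) (t : nat) : (0 < #|V|)%N ->
  (#|[set f : {ffun 'I_t.+1 -> V} | ~~ injectiveb f]| < t.+1 ^ 2 * #|V| ^ t)%N.
Proof.
move=> V0.
have := cardsC [set f : {ffun 'I_t.+1 -> V} | injectiveb f].
rewrite card_inj_ffuns card_ffun card_ord.
have -> : ~: [set f : {ffun 'I_t.+1 -> V} | injectiveb f]
          = [set f : {ffun 'I_t.+1 -> V} | ~~ injectiveb f].
  by apply/setP => f; rewrite !inE.
have := expn_le_ffact #|V| t.
have : (0 < #|V| ^ t)%N by rewrite expn_gt0 V0.
nia.
Qed.

(** Here p is the density of the incidence relation between V and W. By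
    double counting and the power mean inequality the common intersection has
    average density at least p ^ (t + 1) over all maps f. The lower bound on p
    makes the contribution of the non-injective maps less than half of that, so
    some injective map reaches half of the average. *)
Lemma injective_common_large (R : realFieldType) (V W : finType) (t : nat)
    (L : V -> {set W}) :
  let n : R := #|V|%:R in
  let p := (\sum_y #|L y|)%:R / (n * #|W|%:R) in
  2 * t.+1%:R ^+ 2 <= p ^+ t.+1 * n ->
  exists2 f : {ffun 'I_t.+1 -> V}, injective f &
    p ^+ t.+1 / 2 * #|W|%:R <= #|\bigcap_i L (f i)|%:R.
Proof.
move=> n p large; set w : R := #|W|%:R.
have t0 : (0 : R) < t.+1%:R by rewrite ltr0n.
have pn0 : 0 < p ^+ t.+1 * n.
  by apply: lt_le_trans large; rewrite mulr_gt0 ?exprn_gt0 // ltr0n.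
have n0 : 0 < n.
  by rewrite lt0r ler0n andbT; apply: contraTneq pn0 => ->; rewrite mulr0 ltxx.
have V0 : (0 < #|V|)%N by rewrite -(ltr0n R).
have p0 : p != 0.
  by apply: contraTneq pn0 => ->; rewrite exprS !mul0r ltxx.
have w0 : 0 < w.
  rewrite lt0r ler0n andbT; apply: contraNneq p0.
  by rewrite /p -/w => ->; rewrite mulr0 invr0 mulr0.
have [/existsP[f /andP[/injectiveP injf le_f]] | none] := boolP
  [exists f : {ffun 'I_t.+1 -> V}, injectiveb f &&
    (p ^+ t.+1 / 2 * w <= #|\bigcap_i L (f i)|%:R)].
  by exists f.
move: none; rewrite negb_exists => /forallP small.
exfalso; set T := \sum_(f : {ffun 'I_t.+1 -> V}) #|\bigcap_i L (f i)|%N.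
have sumE : (\sum_y #|L y| = \sum_x \sum_y (x \in L y))%N.
  rewrite exchange_big /=; apply: eq_bigr => y _.
  by rewrite -sum1_card big_mkcond.
have lower : p ^+ t.+1 * n ^+ t.+1 * w <= T%:R.
  have := @power_mean_exprn R W t (fun x => (\sum_y (x \in L y))%:R)
            (fun x => ler0n _ _).
  rewrite -natr_sum -sumE -/w.
  have -> : \sum_x (\sum_y (x \in L y))%N%:R ^+ t.+1 = T%:R :> R.
    rewrite /T sum_card_common natr_sum.
    by apply: eq_bigr => x _; rewrite natrX.
  have -> : (\sum_y #|L y|)%:R = p * n * w.
    by rewrite /p -/w -mulrA divfK // mulf_neq0 ?gt_eqF.
  rewrite -[p ^+ t.+1 * _ * w <= _](ler_pM2l (exprn_gt0 t w0)).
  suff -> : w ^+ t * (p ^+ t.+1 * n ^+ t.+1 * w) = (p * n * w) ^+ t.+1 by [].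
  by rewrite !exprMn [w ^+ t.+1]exprS mulrC -!mulrA.
have upper : T%:R < p ^+ t.+1 / 2 * w * n ^+ t.+1 + t.+1%:R ^+ 2 * n ^+ t * w.
  rewrite /T (bigID (fun f : {ffun 'I_t.+1 -> V} => injectiveb f)) /= natrD.
  apply: ler_ltD.
    rewrite natr_sum.
    apply: le_trans (_ : \sum_(f : {ffun 'I_t.+1 -> V} | injectiveb f)
                            (p ^+ t.+1 / 2 * w) <= _).
      apply: ler_sum => f injf.
      by have := small f; rewrite injf /= -ltNge => /ltW.
    rewrite sumr_const -[X in X <= _]mulr_natr ler_pM2l; last first.
      by rewrite !mulr_gt0 ?invr_gt0 //; rewrite -(pmulr_lgt0 _ n0).
    rewrite -natrX ler_nat -[X in (_ ^ X)%N](card_ord t.+1) -card_ffun.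
    exact: max_card.
  apply: le_lt_trans (_ : #|[set f : {ffun 'I_t.+1 -> V} | ~~ injectiveb f]|%:R * w < _).
    rewrite -natrM ler_nat -sum_nat_const.
    rewrite [leqRHS](eq_bigl (fun f : {ffun 'I_t.+1 -> V} => ~~ injectiveb f));
      last by move=> f; rewrite inE.
    by apply: leq_sum => f _; apply: max_card.
  by rewrite ltr_pM2r // -!natrX -natrM ltr_nat card_not_injective.
have := ler_wpM2r (ltW (mulr_gt0 (exprn_gt0 t n0) w0)) large.
move: lower upper; rewrite [n ^+ t.+1]exprS.
set a := p ^+ t.+1; set b := n ^+ t; lra.
Qed.

(** * Dense sets of tuples contain boxes *)

Definition link (V : finType) (r : nat) (E : {set (r.+1).-tuple V}) (y : V) :
  {set r.-tuple V} := [set s : r.-tuple V | [tuple of y :: s] \in E].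

Lemma sum_card_link (V : finType) (r : nat) (E : {set (r.+1).-tuple V}) :
  (\sum_y #|link E y| = #|E|)%N.
Proof.
rewrite -[RHS]sum1_card (partition_big (@thead r V) xpredT) //=.
apply: eq_bigr => y _; rewrite sum1dep_card.
rewrite -(card_imset _ (f := fun s : r.-tuple V => [tuple of y :: s])); last first.
  by move=> s1 s2 /(congr1 val) [] /val_inj.
apply: eq_card => s; rewrite inE; apply/imsetP/andP => [[s' Es' ->] | [Es /eqP <-]].
  by rewrite theadE; move: Es'; rewrite inE.
by exists [tuple of behead s]; [rewrite inE -tuple_eta | exact: tuple_eta].
Qed.

(** In a dense set of (r+1)-tuples some t + 1 distinct first entries share a
    dense common link, with density at least half of the (t + 1)-st power of the
    original one; a box in that link extends to a box in E. The recursion for C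
    pays for this halving, raised to the power (t + 1) ^ r, and for the density
    needed to find distinct first entries. *)
Theorem erdos_box (R : realFieldType) (t r : nat) :
  exists C : nat, forall (V : finType) (E : {set r.-tuple V}),
    C%:R < (#|E|%:R / #|V|%:R ^+ r) ^+ (t.+1 ^ r) * #|V|%:R :> R ->
    exists2 A : 'I_r -> 'I_t.+1 -> V, forall i, injective (A i) &
      forall c : 'I_r -> 'I_t.+1, [tuple A i (c i) | i < r] \in E.
Proof.
elim: r => [|r [C IHr]].
  exists 0%N => V E; rewrite expr0 invr1 mulr1 expn0 expr1 -natrM ltr0n muln_gt0.
  case/andP=> /card_gt0P[s Es] _; exists (fun i : 'I_0 => match notF (ltn_ord i) with end) => [i|c].
    by case: i.
  by rewrite (tuple0 [tuple _ | _ < 0]) -(tuple0 s).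
exists (2 ^ t.+1 ^ r * C + 2 * t.+1 ^ 2)%N => V E.
set n : R := #|V|%:R; set p := _ / _; set N := (t.+1 ^ r)%N => large.
have N0 : (0 < N)%N by rewrite expn_gt0.
have n0 : 0 <= n by [].
have p0 : 0 <= p by rewrite divr_ge0 // exprn_ge0.
(* The density is at most 1, so the first power of q dominates its N-th power. *)
have p1 : p <= 1.
  have [n0E | nn0] := eqVneq (n ^+ r.+1) 0; first by rewrite /p n0E invr0 mulr0.
  rewrite ler_pdivrMr ?mul1r ?lt0r ?nn0 ?exprn_ge0 //.
  by rewrite -natrX ler_nat -card_tuple max_card.
have pE : p = (\sum_y #|link E y|)%:R / (n * #|{: r.-tuple V}|%:R).
  by rewrite sum_card_link card_tuple natrX -exprS.
move: large; rewrite (expnS _ r) exprM -/N natrD !natrM !natrX.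
set q := p ^+ t.+1 => large.
have q0 : 0 <= q by rewrite exprn_ge0.
have q1 : q <= 1 by rewrite exprn_ile1.
have qN : q ^+ N <= q by have := ler_wiXn2l q0 q1 N0; rewrite expr1.
have largeq : 2 * t.+1%:R ^+ 2 <= q * n.
  apply: ltW; apply: lt_le_trans (ler_wpM2r n0 qN).
  by apply: le_lt_trans large; rewrite lerDr mulr_ge0 ?exprn_ge0.
move: (largeq); rewrite /q pE => /injective_common_large[f injf].
rewrite -pE -/q; set F := \bigcap_i _ => le_F.
have [|A injA boxA] := IHr V F.
  rewrite -/n -/N; set p' := _ / _.
  have p'0 : 0 <= p' by rewrite divr_ge0 // exprn_ge0.
  have le_p' : q / 2 <= p'.
    have [m0 | nr0] := posnP #|{: r.-tuple V}|.
      by rewrite /q pE m0 mulr0 invr0 mulr0 exprS !mul0r.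
    by rewrite /p' -natrX -card_tuple ler_pdivlMr ?ltr0n.
  have le_p'N : q ^+ N <= 2 ^+ N * p' ^+ N.
    have le_q2p' : q <= 2 * p' by rewrite mulrC -ler_pdivrMr.
    by rewrite -exprMn lerXn2r // nnegrE (le_trans q0).
  have := ler_wpM2r n0 le_p'N.
  rewrite -mulrA => /(lt_le_trans large) lt_sum.
  rewrite -(ltr_pM2l (exprn_gt0 N (ltr0n R 2))).
  apply: le_lt_trans lt_sum.
  by rewrite lerDl !mulr_ge0.
exists (fun i => if unlift ord0 i is Some j then A j else f) => [i | c].
  by case: unliftP => [j|] _.
have := boxA (fun j => c (lift ord0 j)); move/bigcapP/(_ (c ord0) isT).
rewrite inE; congr (_ \in E); apply: eq_from_tnth => i.
rewrite tnth_mktuple; case: unliftP => [j|] ->; last by rewrite tnth0.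
by rewrite (tnthS _ _ j) tnth_mktuple.
Qed.

(** * Unit distances and orthogonality *)

Definition dot (R : pzSemiRingType) (d : nat) (x y : 'rV[R]_d) : R := \sum_(i < d) x 0 i * y 0 i.

Lemma dotC (R : comPzRingType) d (x y : 'rV[R]_d) : dot x y = dot y x.
Proof. by apply: eq_bigr => i _; rewrite mulrC. Qed.

Lemma dotDr (R : pzRingType) d (x y z : 'rV[R]_d) :
  dot z (x + y) = dot z x + dot z y.
Proof. by rewrite -big_split; apply: eq_bigr => i _; rewrite mxE mulrDr. Qed.

Lemma dotDl (R : pzRingType) d (x y z : 'rV[R]_d) :
  dot (x + y) z = dot x z + dot y z.
Proof. by rewrite -big_split; apply: eq_bigr => i _; rewrite mxE mulrDl. Qed.

Lemma dotZl (R : pzRingType) d a (x z : 'rV[R]_d) : dot (a *: x) z = a * dot x z.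
Proof. by rewrite mulr_sumr; apply: eq_bigr => i _; rewrite mxE mulrA. Qed.

Lemma dotZr (R : comPzRingType) d a (x z : 'rV[R]_d) :
  dot z (a *: x) = a * dot z x.
Proof. by rewrite dotC dotZl dotC. Qed.

Lemma dotBl (R : pzRingType) d (x y z : 'rV[R]_d) :
  dot (x - y) z = dot x z - dot y z.
Proof. by rewrite dotDl -scaleN1r dotZl mulN1r. Qed.

Lemma dotBr (R : comPzRingType) d (x y z : 'rV[R]_d) :
  dot z (x - y) = dot z x - dot z y.
Proof. by rewrite dotC dotBl !(dotC z). Qed.

Lemma dot_suml (R : pzRingType) d (I : finType) (x : I -> 'rV[R]_d) z :
  dot (\sum_i x i) z = \sum_i dot (x i) z.
Proof.
rewrite exchange_big; apply: eq_bigr => k _ /=.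
by rewrite summxE mulr_suml.
Qed.

Lemma dot_eq0 (R : realDomainType) d (x : 'rV[R]_d) : dot x x = 0 -> x = 0.
Proof.
move/eqP; rewrite psumr_eq0 => [/allP x0|i _]; last by rewrite -expr2 sqr_ge0.
apply/rowP => i; have := x0 i (mem_index_enum i).
by rewrite mulf_eq0 orbb mxE => /eqP.
Qed.

(** Vectors from pairwise orthogonal planes that add up to 0 are all 0, as one
    sees by taking the inner product of the sum with each of them. So the 2r
    given vectors are linearly independent. *)
Lemma orthogonal_planes_dim (R : realFieldType) (d r : nat) (u v : 'I_r -> 'rV[R]_d) :
  (forall i a b, a *: u i + b *: v i = 0 -> a = 0 /\ b = 0) ->
  (forall i j a b a' b', i != j ->
     dot (a *: u i + b *: v i) (a' *: u j + b' *: v j) = 0) ->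
  (2 * r <= d)%N.
Proof.
move=> free_uv orth.
pose M := col_mx (\matrix_i u i) (\matrix_i v i).
suff /eqP rankM : row_free M by rewrite mul2n -addnn -rankM rank_leq_col.
apply: inj_row_free => x; rewrite -[x]hsubmxK mul_row_col !mulmx_sum_row -big_split /=.
set a := lsubmx x; set b := rsubmx x.
under eq_bigr => i _ do rewrite !rowK.
pose w i := a 0 i *: u i + b 0 i *: v i; rewrite -/(\sum_i w i) => sum0.
have w0 i : w i = 0.
  apply: dot_eq0; have := congr1 (fun z => dot z (w i)) sum0.
  rewrite dot_suml (bigD1 i) //= big1 ?addr0; last first.
    by move=> j ji; rewrite orth.
  by move->; rewrite /dot big1 // => k _; rewrite mxE mul0r.
have a0 : a = 0 by apply/rowP => i; have [-> _] := free_uv _ _ _ (w0 i); rewrite mxE.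
have b0 : b = 0 by apply/rowP => i; have [_ ->] := free_uv _ _ _ (w0 i); rewrite mxE.
by rewrite a0 b0 row_mx0.
Qed.

(** A line meets a sphere in at most two points: if the points x + u and
    x + s u lie on the same sphere as x, then s ^ 2 - s = 0 and two of the three
    points coincide. *)
Lemma unit_sphere_not_collinear (R : realFieldType) (d : nat) (b x y z : 'rV[R]_d) :
  dot (x - b) (x - b) = 1 -> dot (y - b) (y - b) = 1 -> dot (z - b) (z - b) = 1 ->
  x != y -> x != z -> y != z ->
  forall s t, s *: (y - x) + t *: (z - x) = 0 -> s = 0 /\ t = 0.
Proof.
have proportional (u v w : 'rV[R]_d) s : dot w w = 1 -> dot (u + w) (u + w) = 1 ->
    dot (v + w) (v + w) = 1 -> u != 0 -> v != 0 -> u != v -> u <> s *: v.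
  move=> ww uw vw u0 v0 uv us.
  move: uw vw; rewrite us !(dotDl, dotDr, dotZl, dotZr) ww.
  rewrite (dotC w) => e1 e2.
  have : s * (s - 1) * dot v v = 0.
    by have := congr1 ( *%R s) e2; lra.
  move/eqP; rewrite !mulf_eq0 => /orP[/orP[/eqP s0|/eqP s1]|/eqP /dot_eq0 /eqP].
  - by move: u0; rewrite us s0 scale0r eqxx.
  - by move: uv; rewrite us (_ : s = 1) ?scale1r ?eqxx //; lra.
  - by rewrite (negbTE v0).
move=> bx by_ bz xy xz yz s t st.
have yx0 : y - x != 0 by rewrite subr_eq0 eq_sym.
have zx0 : z - x != 0 by rewrite subr_eq0 eq_sym.
have yzx : y - x != z - x by rewrite (inj_eq (addIr _)).
have yE : y - x + (x - b) = y - b by rewrite addrA subrK.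
have zE : z - x + (x - b) = z - b by rewrite addrA subrK.
have s0 : s = 0.
  apply/eqP; apply/negPn/negP => s0.
  apply: (proportional (y - x) (z - x) (x - b) (- (s^-1 * t))); rewrite ?yE ?zE //.
  apply: (scalerI s0); rewrite scalerA mulrN mulVKf // scaleNr.
  by apply/eqP; rewrite -addr_eq0 st.
split=> //; move/eqP: st; rewrite s0 scale0r add0r scaler_eq0 (negbTE zx0) orbF.
by move/eqP.
Qed.

(** The four squared distances have alternating sum
    2 (x' - x) . (y' - y), up to sign. *)
Lemma equidistant_pairs_orthogonal (R : realFieldType) (d : nat) (D : R)
    (x x' y y' : 'rV[R]_d) :
  dot (x - y) (x - y) = D -> dot (x - y') (x - y') = D ->
  dot (x' - y) (x' - y) = D -> dot (x' - y') (x' - y') = D ->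
  dot (x' - x) (y' - y) = 0.
Proof.
rewrite !(dotBl, dotBr) !(dotC y) !(dotC y'); lra.
Qed.

(** Each part spans a plane because it lies on the unit sphere around a point of
    another part, which exists as there are at least two parts. *)
Lemma no_unit_multipartite (R : realFieldType) (d r : nat) (A : 'I_r -> 'I_3 -> 'rV[R]_d) :
  (1 < r)%N -> (d < 2 * r)%N -> (forall i, injective (A i)) ->
  ~ (forall i j, i != j -> forall k l,
       dot (A i k - A j l) (A i k - A j l) = 1).
Proof.
move=> r1 d_lt injA dist.
pose o1 : 'I_3 := inord 1; pose o2 : 'I_3 := inord 2.
have o01 : ord0 != o1 by rewrite -val_eqE /= inordK.
have o02 : ord0 != o2 by rewrite -val_eqE /= inordK.
have o12 : o1 != o2 by rewrite -val_eqE /= !inordK.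
move: d_lt; rewrite ltnNge => /negP; apply.
apply: (@orthogonal_planes_dim R d r (fun i => A i o1 - A i ord0)
                                     (fun i => A i o2 - A i ord0)) => [i|i j a b a' b' ij].
  have [j ij] : exists j, i != j.
    have lt0r := ltnW r1.
    have [i0|] := eqVneq i (Ordinal lt0r); last by exists (Ordinal lt0r).
    by exists (Ordinal r1); rewrite i0.
  by apply: (@unit_sphere_not_collinear R d (A j ord0)); rewrite ?dist // (inj_eq (injA i)).
have orth k l : dot (A i k - A i ord0) (A j l - A j ord0) = 0.
  by apply: (equidistant_pairs_orthogonal (D := 1)); rewrite dist.
by rewrite dotDl !dotZl !(dotDr (_ *: _)) !dotZr !orth !mulr0 !addr0 !mulr0 addr0.
Qed.

(** * Cliques of distance graphs *)

(** Ordered cliques: the extremal theorem speaks of tuples. *)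
Definition clique_tuples (T : choiceType) (G : graph T) (r : nat) :
    {set r.-tuple (vertices G)} :=
  [set t : r.-tuple (vertices G) |
     [forall i, forall j, (i != j) ==> adj (tnth t i) (tnth t j)]].

Lemma cl_le_clique_tuples (T : choiceType) (G : graph T) (r : nat) :
  (cl G r <= #|clique_tuples G r|)%N.
Proof.
apply: leq_trans (leq_imset_card (fun t : r.-tuple _ => [set x in t]) _).
apply: subset_leq_card; apply/subsetP => K; rewrite inE => /andP[/eqP cardK /forall_inP cliqueK].
have sizeK : size (enum K) == r by rewrite -cardE cardK.
apply/imsetP; exists (Tuple sizeK); last by apply/setP => x; rewrite inE mem_enum.
rewrite inE; apply/forallP => i; apply/forallP => j; apply/implyP => ij.
have inK k : tnth (Tuple sizeK) k \in K by rewrite -mem_enum; apply: mem_tnth.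
have /forall_inP/(_ _ (inK j))/implyP := cliqueK _ (inK i); apply.
by apply: contraNneq ij => /tuple_uniqP/eqP; apply; apply: enum_uniq.
Qed.

Lemma euclidean_dist1 (R : realType) (d : nat) (x y : 'rV[R]_d) :
  euclidean_dist x y = 1 -> dot (x - y) (x - y) = 1.
Proof.
rewrite /euclidean_dist; set s := \sum_(i < d) _ => s1.
have s0 : 0 <= s by apply: sumr_ge0 => i _; apply: sqr_ge0.
rewrite -[RHS](expr1n _ 2) -s1 sqr_sqrtr //.
by apply: eq_bigr => i _; rewrite !mxE expr2.
Qed.

Lemma clique_tuples_no_box (R : realType) (d r : nat) (G : graph 'rV[R]_d)
    (A : 'I_r -> 'I_3 -> vertices G) :
  distance_graph G -> (1 < r)%N -> (d < 2 * r)%N ->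
  (forall i, injective (A i)) ->
  ~ (forall c : 'I_r -> 'I_3, [tuple A i (c i) | i < r] \in clique_tuples G r).
Proof.
move=> distG r1 d_lt injA boxA.
apply: (no_unit_multipartite (A := fun i k => val (A i k)) r1 d_lt) => [i|i j ij k l].
  by move=> k l /val_inj/injA.
apply/euclidean_dist1/distG.
(* Any two vertices from different parts belong to a common tuple of the box. *)
have := boxA (fun m => if m == i then k else l).
rewrite inE => /forallP/(_ i)/forallP/(_ j); rewrite ij !tnth_mktuple eqxx.
by rewrite eq_sym (negbTE ij).
Qed.

Lemma nvertices_dim0 (R : realType) (G : graph 'rV[R]_0) : (nvertices G <= 1)%N.
Proof.
rewrite /nvertices cardfE; apply/card_le1_eqP => x y _ _.
by apply: val_inj; apply/rowP; case.
Qed.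

(* The case d = 1 is excluded because the bound fails there: [1/2] + 1 = 1, and
   a graph with n >= 2 vertices has n > n ^ (1 - eps) cliques of order 1. *)
Theorem theorem5 (R : realType) (d : nat) (hd : d <> 1%N) :
  exists2 eps : R, 0 < eps &
    exists n0 : nat, forall G : graph 'rV[R]_d,
      distance_graph G -> (n0 <= nvertices G)%N ->
      (cl G (d %/ 2 + 1))%:R <=
        (nvertices G)%:R `^ ((d %/ 2 + 1)%:R - eps) :> R.
Proof.
have [d0 | d_gt0] := posnP d.
  subst d; exists 1; first exact: ltr01.
  by exists 2%N => G _ /leq_trans/(_ (nvertices_dim0 G)).
set r := (d %/ 2 + 1)%N.
have [r1 d_lt] : (1 < r)%N /\ (d < 2 * r)%N by split; lia.
(* Boxes with parts of 2 + 1 points, the fewest that can span a plane. *)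
have [C box] := erdos_box R 2 r.
set N := (3 ^ r)%N in box; have N0 : (0 < N)%N by rewrite expn_gt0.
have N20 : (0 : R) < (N * 2)%:R by rewrite ltr0n muln_gt0 N0.
exists (N * 2)%:R^-1; first by rewrite invr_gt0.
exists (C ^ 2 + 1)%N => G distG; rewrite addn1 => n_gt.
have n0 : 0 < (nvertices G)%:R :> R by rewrite ltr0n (leq_ltn_trans _ n_gt).
set n : R := (nvertices G)%:R in n0 *; have n_ge0 : 0 <= n := ltW n0.
have nr0 : 0 < n ^+ r by rewrite exprn_gt0.
set p := (cl G r)%:R / n ^+ r.
have p0 : 0 <= p by rewrite divr_ge0 // ltW.
have sparse : p ^+ N * n <= C%:R.
  apply: le_trans (_ : (#|clique_tuples G r|%:R / n ^+ r) ^+ N * n <= _).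
    have le_p : p <= #|clique_tuples G r|%:R / n ^+ r.
      by rewrite ler_pM2r ?invr_gt0 // ler_nat cl_le_clique_tuples.
    by rewrite ler_pM2r // lerXn2r // nnegrE (le_trans p0).
  rewrite leNgt; apply/negP => dense.
  have [|A injA boxA] := box _ (clique_tuples G r).
    by rewrite -cardfE.
  exact: clique_tuples_no_box distG r1 d_lt injA boxA.
have pn1 : p ^+ (N * 2) * n <= 1.
  have sparse2 : p ^+ (N * 2) * n * n <= n.
    apply: le_trans (_ : C%:R ^+ 2 <= _); last by rewrite -natrX ler_nat ltnW.
    have pNn0 : 0 <= p ^+ N * n by apply: mulr_ge0; [exact: exprn_ge0 | exact: ltW].
    by rewrite exprM -mulrA -expr2 -exprMn lerXn2r // nnegrE.
  by rewrite -(ler_pM2r n0) mul1r.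
rewrite powRD; last by rewrite (gt_eqF n0) implybT.
rewrite powR_mulrn // [leRHS]mulrC -ler_pdivrMr // -/p.
rewrite -(ler_pXn2r (_ : 0 < N * 2)%N) ?nnegrE ?powR_ge0 //; last by rewrite muln_gt0 N0.
rewrite -[leRHS]powR_mulrn ?powR_ge0 // -powRrM mulNr mulVf ?gt_eqF //.
by rewrite powRN powRr1 // -[leRHS]mul1r ler_pdivlMr.
Qed.
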